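(* Let $v^{(1)},\dots,v^{(N)}$ be trajectories on a state space $\mathbb{X}$ and a finite time window $\mathbb{K}=\{1,\dots,K\}$, let $\mathbb{B}=\{0,1\}$, and let $U^{(r)}:\mathbb{B}^{|\mathbb{K}|}\times\mathbb{X}^{|\mathbb{K}|}\to[0,\infty)$ be the cost function defined in the context. For any $\gamma\in\mathbb{B}^{|\mathbb{K}|}$, let $$[x_1^*(\gamma),\dots,x_{|\mathbb{K}|}^*(\gamma)]\triangleq\arg\min_{x\in\mathbb{X}^{|\mathbb{K}|}}U^{(r)}(\gamma,x).$$ If $\gamma_k=0$, or $\mathbf{1}_{\mathcal{D}_{v^{(n)}}}(k)=0$ for all $n=1,\dots,N$, then $x_k^*(\gamma)=\boldsymbol{0}\in\mathbb{X}$. Further, if $\gamma_k=1$, then $$x_k^*(\gamma)=\arg\min_{x_k\in\mathbb{X}}\ \sum_{n:\,\mathcal{D}_{v^{(n)}}\ni k}\frac{[d_{\mathbb{X}}^{(c)}(x_k,v^{(n)}(k))]^r}{|\mathcal{D}_\gamma\cup\mathcal{D}_{v^{(n)}}|}.$$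
   Context: The state space $\mathbb{X}$ carries a metric $d_{\mathbb{X}}$ and has an element denoted $\boldsymbol{0}$; $r$ is a positive integer, $c>0$, and $d_{\mathbb{X}}^{(c)}(y,z)=\min\{d_{\mathbb{X}}(y,z),c\}$. A trajectory $u$ is a function from time instances in $\mathbb{K}$ to $\mathbb{X}$; the set of instances in $\mathbb{K}$ at which its state exists is its domain $\mathcal{D}_u\subseteq\mathbb{K}$, and $\overline{\mathcal{D}}_u=\mathbb{K}\setminus\mathcal{D}_u$. $\mathbf{1}_X(x)=1$ if $x\in X$ and $0$ otherwise. For $(\gamma,x)\in\mathbb{B}^{|\mathbb{K}|}\times\mathbb{X}^{|\mathbb{K}|}$, let $\mathcal{D}_\gamma=\{k\in\mathbb{K}:\gamma_k=1\}$ and $$U^{(r)}(\gamma,x)=\sum_{k\in\mathbb{K}}\Big(\gamma_k\,\psi_k^{(r)}(\gamma,x_k)+(1-\gamma_k)\,\bar\psi_k^{(r)}(\gamma)\Big),$$ $$\psi_k^{(r)}(\gamma,x_k)=\sum_{n=1}^N\frac{\mathbf{1}_{\mathcal{D}_{v^{(n)}}}(k)\,[d_{\mathbb{X}}^{(c)}(x_k,v^{(n)}(k))]^r+\mathbf{1}_{\overline{\mathcal{D}}_{v^{(n)}}}(k)\,c^r}{|\mathcal{D}_\gamma\cup\mathcal{D}_{v^{(n)}}|},\qquad \bar\psi_k^{(r)}(\gamma)=\sum_{n=1}^N\frac{\mathbf{1}_{\mathcal{D}_{v^{(n)}}}(k)\,c^r}{|\mathcal{D}_\gamma\cup\mathcal{D}_{v^{(n)}}|}.$$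 Here ''arg min'' stands for a minimizer; the minimizer $x_k^*(\gamma)$ in the last display of the claim may not be unique, and any minimizer of the cost suffices. *)

(* Defs.v *)
From HB Require Import structures.
From mathcomp Require Import all_boot all_order all_algebra.
From mathcomp Require Import reals metric_structure.

Set Implicit Arguments.
Unset Strict Implicit.
Unset Printing Implicit Defensive.

Import Order.TTheory GRing.Theory Num.Theory.
Local Open Scope ring_scope.

(* The time window {1, ..., K} is represented by 'I_K = {0, ..., K-1}.
   [u k = None] means that the state of [u] does not exist at instance [k]. *)
Definition trajectory (K : nat) (X : Type) := 'I_K -> option X.

Definition dom (K : nat) (X : Type) (u : trajectory K X) : {set 'I_K} :=
  [set k | isSome (u k)].

Definition is_argmin (R : realType) (T : Type) (f : T -> R) (x : T) : Prop :=
  forall y : T, f x <= f y.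

Section Cost.
Context {R : realType} {X : metricType R} (zero : X).
Context {K N : nat} (c : R) (r : nat) (v : 'I_N -> trajectory K X).
Implicit Types (gamma : {ffun 'I_K -> bool}) (x : {ffun 'I_K -> X}).

(* The default [zero] outside the domain is immaterial: every occurrence below
   is multiplied by the indicator of the domain, or summed over it. *)
Definition state (u : trajectory K X) (k : 'I_K) : X := odflt zero (u k).

Definition cutoff_dist (y z : X) : R := Num.min (mdist y z) c.

Definition gdom gamma : {set 'I_K} := [set k | gamma k].

(* If [gamma] and [v n] both have empty domain, the fractions below with
   denominator |gdom gamma :|: dom (v n)| = 0 are 0 by the convention
   a / 0 = 0; they then contribute nothing to [cost], as gamma k = 0
   multiplies [psi] and the numerator in [psi_bar] is 0. *)
Definition psi gamma (k : 'I_K) (xk : X) : R :=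
  \sum_(n < N)
    ((k \in dom (v n))%:R * cutoff_dist xk (state (v n) k) ^+ r
       + (k \in ~: dom (v n))%:R * c ^+ r)
    / #|gdom gamma :|: dom (v n)|%:R.

Definition psi_bar gamma (k : 'I_K) : R :=
  \sum_(n < N)
    ((k \in dom (v n))%:R * c ^+ r) / #|gdom gamma :|: dom (v n)|%:R.

Definition cost gamma x : R :=
  \sum_(k < K)
    ((gamma k)%:R * psi gamma k (x k) + (1 - (gamma k)%:R) * psi_bar gamma k).

Definition instance_cost gamma (k : 'I_K) (xk : X) : R :=
  \sum_(n < N | k \in dom (v n))
    cutoff_dist xk (state (v n) k) ^+ r / #|gdom gamma :|: dom (v n)|%:R.

Lemma cost_ge0 gamma x : 0 < c -> 0 <= cost gamma x.
Proof.
move=> /ltW c0; have cr0 : 0 <= c ^+ r by exact: exprn_ge0.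
apply: sumr_ge0 => k _; apply: addr_ge0; apply: mulr_ge0 => //.
- apply: sumr_ge0 => n _; rewrite divr_ge0 // addr_ge0 // mulr_ge0 //.
  by rewrite exprn_ge0 // /cutoff_dist le_min mdist_ge0.
- by case: (gamma k); rewrite ?subrr ?subr0.
- by apply: sumr_ge0 => n _; rewrite divr_ge0 // mulr_ge0.
Qed.

End Cost.

(* Main.v *)
(* Minimizing over x separates over the instances k: up to a term that does not
   depend on x, the cost is the sum of the instance costs over the k with
   gamma k = 1. *)
Require Import Defs.
From HB Require Import structures.
From mathcomp Require Import all_boot all_order all_algebra.
From mathcomp Require Import reals metric_structure.
Import Order.TTheory GRing.Theory Num.Theory.
Local Open Scope ring_scope.

(** For fixed [gamma] all denominators are constants. An instance with [gamma k = 0] pays [psi_bar],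
    whatever [x k] is; one with [gamma k = 1] pays a constant for the trajectories absent at [k],
    plus [instance_cost] ([psiE]). Hence the minimizers are found coordinatewise ([is_argmin_cost]),
    and where [gamma k = 0] or no trajectory exists at [k], the state is free and can be set to
    [zero]. *)

Lemma is_argmin_sum (R : realType) (I : finType) (X : Type) (P : pred I)
    (f : I -> X -> R) (x : {ffun I -> X}) :
  is_argmin (fun y : {ffun I -> X} => \sum_(i | P i) f i (y i)) x <->
  forall i, P i -> is_argmin (f i) (x i).
Proof.
split=> [xmin i Pi z | xmin y]; last by apply: ler_sum => i Pi; exact: xmin.
(* Compare [x] with its modification at [i] alone: all other summands cancel. *)
have := xmin [ffun j => if j == i then z else x j].
rewrite (bigD1 i) //= [leRHS](bigD1 i) //= ffunE eqxx.
rewrite [X in _ <= _ + X](eq_bigr (fun j => f j (x j))) ?lerD2r //.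
by move=> j /andP[_ /negPf ji]; rewrite ffunE ji.
Qed.

Lemma is_argmin_addl (R : realType) (T : Type) (f g : T -> R) (a : R) (x : T) :
  (forall y, f y = a + g y) -> is_argmin f x <-> is_argmin g x.
Proof.
by move=> fE; split=> xmin y; have := xmin y; rewrite !fE lerD2l.
Qed.

Lemma psiE (R : realType) (X : metricType R) (zero : X) (K N : nat) (c : R)
    (r : nat) (v : 'I_N -> trajectory K X) (gamma : {ffun 'I_K -> bool})
    (k : 'I_K) (xk : X) :
  psi zero c r v gamma k xk =
  \sum_(n < N | k \notin dom (v n)) c ^+ r / #|gdom gamma :|: dom (v n)|%:R
  + instance_cost zero c r v gamma k xk.
Proof.
rewrite /psi /instance_cost (bigID (fun n => k \in dom (v n))) [LHS]addrC /=.
congr (_ + _); apply: eq_bigr => n.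
  by move=> /negPf kv; rewrite in_setC kv mul0r mul1r add0r.
by move=> kv; rewrite in_setC kv mul0r mul1r addr0.
Qed.

Lemma is_argmin_cost (R : realType) (X : metricType R) (zero : X) (K N : nat)
    (c : R) (r : nat) (v : 'I_N -> trajectory K X)
    (gamma : {ffun 'I_K -> bool}) (x : {ffun 'I_K -> X}) :
  is_argmin (cost zero c r v gamma) x <->
  forall k, gamma k -> is_argmin (instance_cost zero c r v gamma k) (x k).
Proof.
apply: iff_trans (@is_argmin_sum R 'I_K X gamma
  (instance_cost zero c r v gamma) x).
(* The part of the cost that is independent of [x]: the penalty split off by [psiE] where [gamma k]
   holds, all of [psi_bar] elsewhere. *)
apply: (@is_argmin_addl _ _ _ _ (\sum_(k < K) if gamma k then
  \sum_(n < N | k \notin dom (v n)) c ^+ r / #|gdom gamma :|: dom (v n)|%:R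
  else psi_bar c r v gamma k)) => y.
rewrite /cost [X in _ + X]big_mkcond -big_split; apply: eq_bigr => k _ /=.
case: (gamma k); first by rewrite mul1r subrr mul0r addr0 psiE.
by rewrite mul0r subr0 mul1r add0r addr0.
Qed.

(** Minimizers need not be unique, so the value [zero] is a choice: it is compatible with
    minimality, and any minimizer can be overwritten to make it. *)
Theorem proposition3 (R : realType) (X : metricType R) (zero : X)
    (K N : nat) (c : R) (r : nat) (hc : 0 < c) (hr : (0 < r)%N)
    (v : 'I_N -> trajectory K X) (gamma : {ffun 'I_K -> bool}) :
  (forall x : {ffun 'I_K -> X},
     (forall k : 'I_K,
        gamma k = false \/ (forall n : 'I_N, k \notin dom (v n)) ->
        x k = zero) ->
     (forall k : 'I_K, gamma k = true ->
        is_argmin (instance_cost zero c r v gamma k) (x k)) ->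
     is_argmin (cost zero c r v gamma) x)
  /\
  (forall x : {ffun 'I_K -> X},
     is_argmin (cost zero c r v gamma) x ->
     (forall k : 'I_K, gamma k = true ->
        is_argmin (instance_cost zero c r v gamma k) (x k))
     /\
     is_argmin (cost zero c r v gamma)
       [ffun k => if ~~ gamma k || [forall n, k \notin dom (v n)]
                  then zero else x k]).
Proof.
split=> [x _ xmin | x /is_argmin_cost xmin]; first exact/is_argmin_cost.
split=> //; apply/is_argmin_cost => k gk; rewrite ffunE gk /=.
case: ifP => [/forallP kv y | _]; last exact: xmin.
(* No trajectory exists at [k], so [instance_cost] is an empty sum and every point minimizes it. *)
by rewrite /instance_cost !big_pred0 // => n; exact/negbTE/kv.
Qed.
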